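(* Let $M=(X,d)$ be a metric space with $\eta(M)>0$, and let $M'$ be a metric space. The lexicographic metric space $M\circ M'$ is separable if and only if $X$ is a countable set and $M'$ is separable.
   Context: All metric spaces are nonempty. ''Countable'' means finite or countably infinite. For a metric space $M=(X,d)$ and $x\in X$, the nearness of $x$ is $\eta(x)=\inf\{d(x,y): y\in X\setminus\{x\}\}$ and the nearness of $M$ is $\eta(M)=\inf\{\eta(x): x\in X\}$ (with $\inf\emptyset=+\infty$). If $M=(X,d)$ and $M'=(Y,d_Y)$ are metric spaces with $\eta(M)>0$, the lexicographic metric space is $M\circ M'=(X\times Y,\rho)$, where $\rho((x,y),(x',y'))=d(x,x')$ if $x\neq x'$, and $\rho((x,y),(x',y'))=\min\{2\eta(x),d_Y(y,y')\}$ if $x=x'$; $\rho$ is a metric. A metric space is separable if it has a countable dense subset. *)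

(* Defs.v *)
From HB Require Import structures.
From mathcomp Require Import all_boot all_order all_algebra.
From mathcomp Require Import all_classical all_reals.
From mathcomp Require Import ereal topology metric_structure.

Set Implicit Arguments.
Unset Strict Implicit.
Unset Printing Implicit Defensive.

Import Order.TTheory GRing.Theory Num.Theory.
Local Open Scope classical_set_scope.
Local Open Scope ring_scope.

Definition separable (T : topologicalType) : Prop :=
  exists2 A : set T, countable A & dense A.

Section Nearness.
Context {R : realType} (X : metricType R).

(* [ereal_inf set0] is [+oo], so a one-point space has nearness [+oo]. *)
Definition point_nearness (x : X) : \bar R :=
  ereal_inf [set (mdist x y)%:E | y in [set~ x]].

Definition nearness : \bar R := ereal_inf (range point_nearness).

Lemma nearness_le_point x : (nearness <= point_nearness x)%E.
Proof. by apply: ereal_inf_lbound; exists x. Qed.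

Lemma point_nearness_le x y : y != x -> (point_nearness x <= (mdist x y)%:E)%E.
Proof. by move=> /eqP yx; apply: ereal_inf_lbound; exists y. Qed.

End Nearness.

Section LexDist.
Context {R : realType} (X Y : metricType R).
Implicit Types p q r : X * Y.

(* The minimum is taken in [\bar R] since [point_nearness] may be [+oo]; it is
   always finite (see [lex_dist_eqE]), so [fine] loses no information. *)
Definition lex_dist p q : R :=
  if p.1 == q.1
  then fine (mine (2%:E * point_nearness p.1)%E (mdist p.2 q.2)%:E)
  else mdist p.1 q.1.

Lemma lex_dist_neqE p q : p.1 != q.1 -> lex_dist p q = mdist p.1 q.1.
Proof. by rewrite /lex_dist => /negbTE ->. Qed.

Hypothesis X_gt0 : (0 < nearness X)%E.

Let pn_gt0 x : (0 < point_nearness (x : X))%E.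
Proof. exact: (lt_le_trans X_gt0 (nearness_le_point x)). Qed.

Lemma lex_dist_eqE p q : p.1 = q.1 ->
  (lex_dist p q)%:E = mine (2%:E * point_nearness p.1)%E (mdist p.2 q.2)%:E.
Proof.
move=> pq; rewrite /lex_dist pq eqxx fineK//.
have := pn_gt0 q.1; case: (point_nearness q.1) => [e|_|//].
  by rewrite -EFinM -EFin_min.
by rewrite mulry gtr0_sg// mul1e minye.
Qed.

Let lex_dist_le2 p q : p.1 = q.1 -> lex_dist p q <= mdist p.2 q.2.
Proof.
by move=> pq; rewrite -lee_fin lex_dist_eqE// ge_min lexx orbT.
Qed.

Let lex_dist_le1 p q x : p.1 = q.1 -> x != p.1 ->
  lex_dist p q <= mdist p.1 x + mdist p.1 x.
Proof.
move=> pq xp; rewrite -lee_fin lex_dist_eqE// ge_min; apply/orP; left.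
rewrite -mulr2n -[mdist _ _ *+ 2]mulr_natl EFinM.
apply: lee_wpmul2l; rewrite ?lee_fin//.
exact: point_nearness_le.
Qed.

Lemma lex_dist_xx p : lex_dist p p = 0.
Proof.
apply: EFin_inj; rewrite lex_dist_eqE// mdistxx min_r//.
by rewrite mule_ge0// ltW.
Qed.

Let lex_dist_ge0 p q : 0 <= lex_dist p q.
Proof.
have [pq|pq] := eqVneq p.1 q.1; last by rewrite lex_dist_neqE// mdist_ge0.
rewrite -lee_fin lex_dist_eqE// le_min lee_fin mdist_ge0 andbT.
by rewrite mule_ge0// ltW.
Qed.

Lemma lex_dist_eq0 p q : lex_dist p q = 0 -> p = q.
Proof.
have [pq /(congr1 (@EFin R))|pq] := eqVneq p.1 q.1; last first.
  by rewrite lex_dist_neqE// => /mdist_positivity/eqP; rewrite (negbTE pq).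
rewrite lex_dist_eqE//.
have h : (0 < 2%:E * point_nearness p.1)%E by rewrite mule_gt0.
rewrite minEle; case: ifPn => _ h0; first by rewrite h0 ltxx in h.
case: h0 => /mdist_positivity; case: p q pq {h} => [a b] [c d] /=.
by move=> -> ->.
Qed.

Lemma lex_dist_sym p q : lex_dist p q = lex_dist q p.
Proof.
have [pq|pq] := eqVneq p.1 q.1.
  by apply: EFin_inj; rewrite !lex_dist_eqE// pq metric_sym.
by rewrite !lex_dist_neqE// 1?eq_sym// metric_sym.
Qed.

Lemma lex_dist_triangle q p r : lex_dist p r <= lex_dist p q + lex_dist q r.
Proof.
have [pr|pr] := eqVneq p.1 r.1; last first.
  rewrite (lex_dist_neqE pr).
  have [pq|pq] := eqVneq p.1 q.1.
    have qr : q.1 != r.1 by rewrite -pq.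
    by rewrite (lex_dist_neqE qr) pq lerDr.
  have [qr|qr] := eqVneq q.1 r.1.
    by rewrite (lex_dist_neqE pq) qr lerDl.
  by rewrite !lex_dist_neqE// metric_triangle.
have [pq|pq] := eqVneq p.1 q.1; last first.
  have qr : q.1 != r.1 by rewrite -pr eq_sym.
  rewrite (lex_dist_neqE pq) (lex_dist_neqE qr) -pr (metric_sym q.1).
  by apply: lex_dist_le1; rewrite // eq_sym.
have qr : q.1 = r.1 by rewrite -pq.
set t := (2%:E * point_nearness p.1)%E.
have ed u v : u.1 = p.1 -> v.1 = p.1 ->
    (lex_dist u v)%:E = mine t (mdist u.2 v.2)%:E.
  by move=> up vp; rewrite lex_dist_eqE ?up// vp.
have hpr : ((lex_dist p r)%:E <= t)%E by rewrite ed// ge_min lexx.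
have := ed p q erefl (esym pq); rewrite minEle; case: ifPn => _ epq.
  by rewrite -lee_fin EFinD epq (le_trans hpr)// leeDl// lee_fin.
have := ed q r (esym pq) (esym pr); rewrite minEle; case: ifPn => _ eqr.
  by rewrite -lee_fin EFinD eqr (le_trans hpr)// leeDr// lee_fin.
case: epq eqr => -> [->].
exact: le_trans (lex_dist_le2 pr) (metric_triangle _ _ _).
Qed.

End LexDist.

(* An alias of [X * Y]: the bare product carries the product topology. The
   proof of [0 < nearness X] is a parameter of the space because [lex_dist] is
   a metric only under that condition. *)
Definition lex_space (R : realType) (X Y : metricType R)
  (X_gt0 : (0 < nearness X)%E) : Type := (X * Y)%type.
Arguments lex_space {R} X Y X_gt0.

Section LexSpace.
Context {R : realType} (X Y : metricType R) (X_gt0 : (0 < nearness X)%E).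

HB.instance Definition _ := Choice.copy (lex_space X Y X_gt0) (X * Y)%type.
HB.instance Definition _ := @isMetric.Build R (lex_space X Y X_gt0)
  (@lex_dist R X Y) (lex_dist_xx X_gt0) (lex_dist_eq0 X_gt0)
  (lex_dist_sym X_gt0) (lex_dist_triangle X_gt0).

Lemma lex_mdistE (p q : lex_space X Y X_gt0) : mdist p q = lex_dist p q.
Proof. by []. Qed.

End LexSpace.

(* Main.v *)
Require Import Defs.
From HB Require Import structures.
From mathcomp Require Import all_boot all_order all_algebra.
From mathcomp Require Import all_classical all_reals.
From mathcomp Require Import ereal topology metric_structure.

(** When [nearness X] is positive, there is a radius [e0] below which the
   lexicographic metric no longer sees the first factor: for [e <= e0], the
   ball of radius [e] around [(x, y)] is [{x}] times the ball of radius [e]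
   around [y] ([lex_dist_ltP]). Moving to another first coordinate costs at
   least [point_nearness x >= e0], and the truncation at
   [2 * point_nearness x] is not attained below [e0]. Topologically, the
   lexicographic space is thus a disjoint union of copies of [Y], one for each
   point of [X].

   A dense set therefore meets every fibre, so its first projection is all of
   [X], and its second projection is dense in [Y]. Both projections of a
   countable set are countable. Conversely, if [X] is countable and [B] is a
   countable dense subset of [Y], then [X * B] is countable and dense. *)

Set Implicit Arguments.
Unset Strict Implicit.
Unset Printing Implicit Defensive.

Import Order.TTheory GRing.Theory Num.Theory.
Local Open Scope classical_set_scope.
Local Open Scope ring_scope.

Lemma mdist_denseP (R : realType) (T : metricType R) (A : set T) :
  dense A <-> forall x e, 0 < e -> exists2 a, A a & mdist x a < e.
Proof.
split=> [dA x e e0|dA O [x Ox] oO].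
  have [a [+ Aa]] := dA _ (ex_intro _ x (open_nbhs_ball x (PosNum e0)).2)
    (open_nbhs_ball x (PosNum e0)).1.
  by move=> /interior_subset; rewrite ballEmdist; exists a.
have /nbhs_ballP[e /= e0 xeO] : nbhs x O by exact: open_nbhs_nbhs.
have [a Aa xa] := dA x e e0.
by exists a; split=> //; apply: xeO; rewrite ballEmdist.
Qed.

(** Provides a real radius even where the nearness is infinite, that is, when
   [X] has a single point. *)
Lemma ereal_gt0_lower (R : realType) (u : \bar R) : (0 < u)%E ->
  exists2 e : R, 0 < e & (e%:E <= u)%E.
Proof.
case: u => [r||//]; first by rewrite lte_fin; exists r.
by exists 1; rewrite ?leey.
Qed.

(** Two distinct first coordinates are at distance at least [e], and the
   truncation level of a fibre is at least [e], so neither case of the metric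
   interferes with a comparison to [e]. *)
Lemma lex_dist_ltP (R : realType) (X Y : metricType R)
    (X_gt0 : (0 < nearness X)%E) (e : R) (p q : X * Y) :
  (e%:E <= nearness X)%E ->
  lex_dist p q < e <-> p.1 = q.1 /\ mdist p.2 q.2 < e.
Proof.
move=> eX; have ep : (e%:E <= point_nearness p.1)%E.
  exact: le_trans eX (nearness_le_point _).
have [pq|pq] := eqVneq p.1 q.1; last first.
  split=> [|[/eqP]]; last by rewrite (negbTE pq).
  rewrite lex_dist_neqE// ltNge -lee_fin (le_trans ep)//.
  by rewrite point_nearness_le// eq_sym.
have e2p : (e%:E <= 2%:E * point_nearness p.1)%E.
  rewrite (le_trans ep)// lee_pemull ?lee_fin ?ler1n//.
  exact: le_trans (ltW X_gt0) (nearness_le_point _).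
rewrite -(lte_fin (lex_dist p q)) (lex_dist_eqE X_gt0 pq) gt_min ltNge e2p /= lte_fin.
by split=> [|[]].
Qed.

Lemma lex_dist_fibre_le (R : realType) (X Y : metricType R)
    (X_gt0 : (0 < nearness X)%E) (x : X) (y z : Y) :
  lex_dist (x, y) (x, z) <= mdist y z.
Proof. by rewrite -lee_fin (lex_dist_eqE X_gt0)// ge_min lexx orbT. Qed.

Lemma dense_lexX (R : realType) (X Y : metricType R)
    (X_gt0 : (0 < nearness X)%E) (B : set Y) :
  dense B -> dense (setT `*` B : set (lex_space X Y X_gt0)).
Proof.
move=> /mdist_denseP dB; apply/mdist_denseP => -[x y] e e0.
have [b Bb yb] := dB y e e0; exists (x, b) => //.
by rewrite lex_mdistE (le_lt_trans _ yb)// lex_dist_fibre_le.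
Qed.

Section DenseProjections.
Context (R : realType) (X Y : metricType R) (X_gt0 : (0 < nearness X)%E).
Context (A : set (lex_space X Y X_gt0)) (dA : dense A).

Lemma dense_lex_fst (y : Y) : fst @` A = [set: X].
Proof.
apply/seteqP; split=> // x _.
have [e e0 eX] := ereal_gt0_lower X_gt0.
have [a Aa] := (mdist_denseP A).1 dA (x, y) e e0.
by rewrite lex_mdistE => /lex_dist_ltP -/(_ X_gt0 eX)[/= xa _]; exists a.
Qed.

Lemma dense_lex_snd (x : X) : dense (snd @` A : set Y).
Proof.
apply/mdist_denseP => y e e0.
have [r r0 rX] := ereal_gt0_lower X_gt0.
(* radii above the nearness would let the ball leave the fibre of [x] *)
have m0 : 0 < Num.min e r by rewrite lt_min e0.
have mX : ((Num.min e r)%:E <= nearness X)%E.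
  by rewrite (le_trans _ rX)// lee_fin ge_min lexx orbT.
have [a Aa] := (mdist_denseP A).1 dA (x, y) _ m0.
rewrite lex_mdistE => /lex_dist_ltP -/(_ X_gt0 mX)[_ /=].
by rewrite lt_min => /andP[ya _]; exists a.2 => //; exists a.
Qed.

End DenseProjections.

Theorem theorem12 (R : realType) (X Y : metricType R)
    (X_neq0 : [set: X] !=set0) (Y_neq0 : [set: Y] !=set0)
    (X_gt0 : (0 < nearness X)%E) :
  separable (lex_space X Y X_gt0) <-> countable [set: X] /\ separable Y.
Proof.
split=> [[A cA dA]|[cX [B cB dB]]].
  have [[x _] [y _]] := (X_neq0, Y_neq0).
  have cim (T : Type) (f : X * Y -> T) : countable (f @` A).
    exact: sub_countable (card_image_le f A) cA.
  split; first by rewrite -(dense_lex_fst dA y).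
  by exists (snd @` A) => //; exact: dense_lex_snd.
by exists (setT `*` B); [exact: countableX|exact: dense_lexX].
Qed.
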